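(* Let $I\subset\mathbb{R}$ be an interval and let $q:I\to\mathbb{H}$ be a regular quaternionic curve parametrized by its length (so $|q'(t)|=1$ for all $t\in I$), with quaternionic curvature $\kappa=\kappa_1i+\kappa_2j+\kappa_3k$ such that $\kappa(t)\neq0$ for all $t\in I$ and $\omega=\kappa/|\kappa|$ is constant on $I$. Let $$q_E(t)=q(t)+\omega\,\frac{1}{|\kappa(t)|}\,q'(t)$$ be its center of curvature, and assume that $q_E$ is a regular curve on $I$. Let $\kappa_E=\kappa_{E1}i+\kappa_{E2}j+\kappa_{E3}k$ be the quaternionic curvature of $q_E$. Then for each $m\in\{1,2,3\}$, at every point of $I$, $$\kappa_{Em}\,\big|q_E'\big|=\kappa_m .$$
   Context: $\mathbb{H}$ denotes the quaternions $q=x_0+x_1i+x_2j+x_3k$ with $x_\mu\in\mathbb{R}$ and $i^2=j^2=k^2=ijk=-1$; $\overline q=x_0-x_1i-x_2j-x_3k$ and $|q|^2=q\overline q$. A quaternionic curve is a map $I\to\mathbb{H}$ whose four real components are $C^\infty$ functions on $I$; primes denote componentwise derivatives with respect to $t$. The curve is regular if its derivative vanishes nowhere on $I$. The quaternionic curvature of a regular curve $p$ is the pure imaginary quaternion-valued function $\kappa_p=\kappa_{p1}i+\kappa_{p2}j+\kappa_{p3}k$ (with real component functions) determined by $\frac{d}{dt}\left(\frac{p'}{|p'|}\right)=\kappa_p\,p'$; in particular $q''=\kappa q'$ if $|q'|=1$. All products are quaternion multiplication. *)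

(* Defs.v *)
From Stdlib Require Import Reals Lra.

Open Scope R_scope.

Record quat : Type := Quat { re : R; im1 : R; im2 : R; im3 : R }.

Declare Scope quat_scope.
Delimit Scope quat_scope with H.
Bind Scope quat_scope with quat.

Definition qreal (r : R) : quat := Quat r 0 0 0.
Definition qi : quat := Quat 0 1 0 0.
Definition qj : quat := Quat 0 0 1 0.
Definition qk : quat := Quat 0 0 0 1.

Definition qadd (p q : quat) : quat :=
  Quat (re p + re q) (im1 p + im1 q) (im2 p + im2 q) (im3 p + im3 q).

Definition qmul (p q : quat) : quat :=
  Quat (re p * re q - im1 p * im1 q - im2 p * im2 q - im3 p * im3 q)
       (re p * im1 q + im1 p * re q + im2 p * im3 q - im3 p * im2 q)
       (re p * im2 q - im1 p * im3 q + im2 p * re q + im3 p * im1 q)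
       (re p * im3 q + im1 p * im2 q - im2 p * im1 q + im3 p * re q).

Definition qscale (r : R) (q : quat) : quat :=
  Quat (r * re q) (r * im1 q) (r * im2 q) (r * im3 q).

Definition qconj (q : quat) : quat := Quat (re q) (- im1 q) (- im2 q) (- im3 q).

Infix "+" := qadd : quat_scope.
Infix "*" := qmul : quat_scope.

Definition qnorm (q : quat) : R := sqrt (re (q * qconj q)%H).

Lemma hamilton_relations :
  (qi * qi = qreal (-1) /\ qj * qj = qreal (-1) /\
   qk * qk = qreal (-1) /\ qi * qj * qk = qreal (-1))%H.
Proof.
  unfold qmul, qi, qj, qk, qreal; simpl; repeat split; f_equal; ring.
Qed.

Lemma qmul_conj (q : quat) : (q * qconj q)%H = qreal (qnorm q ^ 2).
Proof.
  unfold qnorm; rewrite pow2_sqrt.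
  - destruct q; unfold qmul, qconj, qreal; simpl; f_equal; ring.
  - destruct q; unfold qmul, qconj; simpl; nra.
Qed.

Lemma qscale_qreal (r : R) (q : quat) : qscale r q = (qreal r * q)%H.
Proof.
  unfold qscale, qmul, qreal; destruct q; simpl; f_equal; ring.
Qed.

(** Open, half-open, closed and unbounded intervals are all covered; an
    interval reduced to one point is excluded, since derivatives relative to
    it would be meaningless. *)
Definition is_interval (I : R -> Prop) : Prop :=
  (forall a b t : R, I a -> I b -> a <= t <= b -> I t) /\
  (exists a b : R, I a /\ I b /\ a < b).

(** Maps [I -> quat] are represented by functions on [R] of which only the
    values on [I] matter: [D_in f d I t] takes the limit of the difference
    quotients along points of [I], so it is the one-sided derivative at an
    endpoint belonging to [I]. *)

Definition smooth_on (I : R -> Prop) (f : R -> R) : Prop :=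
  exists d : nat -> R -> R,
    (forall t, I t -> d O t = f t) /\
    (forall n t, I t -> D_in (d n) (d (S n)) I t).

Definition quat_curve (I : R -> Prop) (p : R -> quat) : Prop :=
  smooth_on I (fun t => re (p t)) /\ smooth_on I (fun t => im1 (p t)) /\
  smooth_on I (fun t => im2 (p t)) /\ smooth_on I (fun t => im3 (p t)).

Definition is_derivative (I : R -> Prop) (p dp : R -> quat) : Prop :=
  forall t, I t ->
    D_in (fun s => re (p s)) (fun s => re (dp s)) I t /\
    D_in (fun s => im1 (p s)) (fun s => im1 (dp s)) I t /\
    D_in (fun s => im2 (p s)) (fun s => im2 (dp s)) I t /\
    D_in (fun s => im3 (p s)) (fun s => im3 (dp s)) I t.

Definition regular_curve (I : R -> Prop) (p dp : R -> quat) : Prop :=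
  quat_curve I p /\ is_derivative I p dp /\
  (forall t, I t -> dp t <> qreal 0).

(** The curvature of a regular curve depends on it only through its derivative
    [dp], and the conditions below determine [kappa] on [I]. *)
Definition is_curvature (I : R -> Prop) (dp kappa : R -> quat) : Prop :=
  (forall t, I t -> re (kappa t) = 0) /\
  is_derivative I (fun t => qscale (/ qnorm (dp t)) (dp t))
                  (fun t => (kappa t * dp t)%H).

Definition center_of_curvature (q dq kappa : R -> quat) (omega : quat)
    (t : R) : quat :=
  (q t + omega * qscale (1 / qnorm (kappa t)) (dq t))%H.

(* Main.v *)
Require Import Defs.
From Stdlib Require Import Reals.
From Stdlib Require Import Lra.

Open Scope R_scope.

(** Write [r = 1/|kappa|] and [u = omega q']. Since [kappa] is a real multiple
    of the constant imaginary unit [omega], the two commute, so [q'' = kappa q']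
    gives [u' = omega kappa q' = kappa u], and [omega^2 = -1] gives
    [omega (r kappa) q' = omega^2 q' = - q']. In the derivative of
    [q_E = q + omega r q'] the terms in [q'] therefore cancel, and
    [q_E' = r' u]: the tangent of the evolute is a real multiple of the unit
    field [u]. Hence the unit tangent [T] of [q_E] is [e u] with [e] real and
    [e^2 = 1].

    The sign [e] has zero derivative: it is differentiable, because it is
    recovered as the real part of [T] times the conjugate of [u], and
    differentiating [e^2 = 1] gives [2 e e' = 0] with [e <> 0]. So
    [T' = e kappa u = kappa T] ([unit_parallel_derivative]). By definition of
    the curvature of [q_E] also [T' = kappa_E q_E' = kappa_E |q_E'| T], and
    cancelling the unit quaternion [T] gives [kappa_E |q_E'| = kappa].

    Differentiability of [r] is obtained in the same way as that of [e], since
    [q_E - q = r u] ([real_factor_derivable]). *)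

(** * Quaternion algebra *)

Lemma quat_eq (p q : quat) :
  re p = re q -> im1 p = im1 q -> im2 p = im2 q -> im3 p = im3 q -> p = q.
Proof. destruct p, q; simpl; intros; subst; reflexivity. Qed.

Ltac quat_ring := apply quat_eq; simpl; ring.

Lemma qmul_assoc (p q r : quat) : (p * (q * r) = p * q * r)%H.
Proof. quat_ring. Qed.

Lemma qmul_qreal_comm (r : R) (p : quat) : (p * qreal r = qreal r * p)%H.
Proof. quat_ring. Qed.

Lemma qmul_1_l (p : quat) : (qreal 1 * p = p)%H.
Proof. quat_ring. Qed.

Lemma qmul_1_r (p : quat) : (p * qreal 1 = p)%H.
Proof. quat_ring. Qed.

Lemma qreal_mul (a b : R) : (qreal a * qreal b = qreal (a * b))%H.
Proof. quat_ring. Qed.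

Lemma qconj_mul (p q : quat) : qconj (p * q)%H = (qconj q * qconj p)%H.
Proof. quat_ring. Qed.

Lemma qreal_inj (a b : R) : qreal a = qreal b -> a = b.
Proof. intros H; injection H; auto. Qed.

Lemma qnorm_neq0 (p : quat) : p <> qreal 0 -> qnorm p <> 0.
Proof.
  intros Hp H0; apply Hp.
  pose proof (f_equal re (qmul_conj p)) as H.
  rewrite H0 in H; destruct p as [a b c d]; simpl in H.
  unfold qreal; f_equal; nra.
Qed.

Definition unit_quat (u : quat) : Prop := (u * qconj u = qreal 1)%H.

Lemma unit_quat_mul (u v : quat) :
  unit_quat u -> unit_quat v -> unit_quat (u * v)%H.
Proof.
  unfold unit_quat; intros Hu Hv.
  rewrite qconj_mul, <- qmul_assoc, (qmul_assoc v), Hv, qmul_1_l; exact Hu.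
Qed.

Lemma qnorm_1_unit (u : quat) : qnorm u = 1 -> unit_quat u.
Proof.
  intros H; unfold unit_quat; rewrite qmul_conj, H; f_equal; ring.
Qed.

Lemma unit_quat_cancel_r (a b u : quat) :
  unit_quat u -> (a * u = b * u)%H -> a = b.
Proof.
  intros Hu H.
  rewrite <- (qmul_1_r a), <- (qmul_1_r b), <- Hu, !qmul_assoc, H; reflexivity.
Qed.

Lemma normalize_unit (p : quat) :
  p <> qreal 0 -> unit_quat (qscale (/ qnorm p) p).
Proof.
  intros Hp; pose proof (qnorm_neq0 p Hp) as Hn.
  assert (H : (qscale (/ qnorm p) p * qconj (qscale (/ qnorm p) p)
               = qscale ((/ qnorm p) ^ 2) (p * qconj p))%H) by quat_ring.
  unfold unit_quat; rewrite H, qmul_conj.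
  apply quat_eq; simpl; field; exact Hn.
Qed.

Lemma qscale_normalize (p : quat) :
  p <> qreal 0 -> p = qscale (qnorm p) (qscale (/ qnorm p) p).
Proof.
  intros Hp; pose proof (qnorm_neq0 p Hp).
  apply quat_eq; simpl; field; assumption.
Qed.

Lemma imaginary_unit_square (w : quat) :
  re w = 0 -> unit_quat w -> (w * w = qreal (-1))%H.
Proof.
  intros Hre Hw.
  (* An imaginary quaternion is the opposite of its conjugate. *)
  assert (H : (w * w = qreal (-1) * (w * qconj w))%H)
    by (apply quat_eq; simpl; rewrite Hre; ring).
  rewrite H, Hw, qreal_mul; f_equal; ring.
Qed.

(** The real coefficient of a multiple of a unit quaternion is a bilinear
    expression in the two quaternions, hence as regular as they are. *)
Lemma real_factor_of_unit (s : R) (x u : quat) :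
  unit_quat u -> (x = qreal s * u)%H -> s = re (x * qconj u)%H.
Proof.
  intros Hu ->; rewrite <- qmul_assoc, Hu; simpl; ring.
Qed.

Lemma unit_real_factor_square (s : R) (x u : quat) :
  unit_quat u -> unit_quat x -> (x = qreal s * u)%H -> s * s = 1.
Proof.
  unfold unit_quat; intros Hu Hx ->; apply qreal_inj.
  rewrite <- Hx, qconj_mul, <- qmul_assoc, (qmul_assoc u), Hu, qmul_1_l.
  quat_ring.
Qed.

(** * Derivatives relative to a set *)

Lemma D_in_ext (I : R -> Prop) (f g d : R -> R) (t : R) :
  I t -> (forall s, I s -> f s = g s) -> D_in f d I t -> D_in g d I t.
Proof.
  intros It Hfg Hf eps Heps; destruct (Hf eps Heps) as [alp [Halp H]].
  exists alp; split; [exact Halp|].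
  intros x Hx; rewrite <- (Hfg x), <- (Hfg t); [exact (H x Hx) | exact It |].
  apply Hx.
Qed.

Lemma interval_adherent (I : R -> Prop) (t : R) :
  is_interval I -> I t -> adhDa (D_x I t) t.
Proof.
  intros [Hconv [a [b [Ia [Ib Hab]]]]] It alp Halp.
  destruct (Rlt_le_dec t b) as [Htb | Htb].
  - pose proof (Rmin_l (alp / 2) (b - t)); pose proof (Rmin_r (alp / 2) (b - t)).
    assert (0 < Rmin (alp / 2) (b - t)) by (apply Rmin_pos; lra).
    exists (t + Rmin (alp / 2) (b - t)); split; [split|].
    + apply (Hconv t b); auto; lra.
    + lra.
    + unfold Rdist; rewrite Rabs_pos_eq; lra.
  - pose proof (Rmin_l (alp / 2) (t - a)); pose proof (Rmin_r (alp / 2) (t - a)).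
    assert (0 < Rmin (alp / 2) (t - a)) by (apply Rmin_pos; lra).
    exists (t - Rmin (alp / 2) (t - a)); split; [split|].
    + apply (Hconv a t); auto; lra.
    + lra.
    + unfold Rdist; rewrite Rabs_left; lra.
Qed.

Lemma D_in_unique (I : R -> Prop) (f d1 d2 : R -> R) (t : R) :
  is_interval I -> I t -> D_in f d1 I t -> D_in f d2 I t -> d1 t = d2 t.
Proof.
  intros HI It H1 H2.
  exact (single_limit _ _ _ _ _ (interval_adherent I t HI It) H1 H2).
Qed.

(** The derivative at [t] is given by its value [v], so that derivatives
    computed by the product rule need no surrounding function; at each [t] of
    [I], [is_derivative I p dp] is convertible to [qderiv I t p (dp t)]. *)
Definition qderiv (I : R -> Prop) (t : R) (p : R -> quat) (v : quat) : Prop :=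
  D_in (fun s => re (p s)) (fun _ => re v) I t /\
  D_in (fun s => im1 (p s)) (fun _ => im1 v) I t /\
  D_in (fun s => im2 (p s)) (fun _ => im2 v) I t /\
  D_in (fun s => im3 (p s)) (fun _ => im3 v) I t.

Lemma qderiv_ext (I : R -> Prop) (t : R) (p1 p2 : R -> quat) (v : quat) :
  I t -> (forall s, I s -> p1 s = p2 s) -> qderiv I t p1 v -> qderiv I t p2 v.
Proof.
  intros It Hp (H0 & H1 & H2 & H3).
  repeat split; (eapply D_in_ext; [exact It | | eassumption]);
    intros s Is; simpl; rewrite (Hp s Is); reflexivity.
Qed.

Lemma qderiv_unique (I : R -> Prop) (t : R) (p : R -> quat) (v w : quat) :
  is_interval I -> I t -> qderiv I t p v -> qderiv I t p w -> v = w.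
Proof.
  intros HI It (H0 & H1 & H2 & H3) (K0 & K1 & K2 & K3).
  apply quat_eq.
  - exact (D_in_unique _ _ _ _ _ HI It H0 K0).
  - exact (D_in_unique _ _ _ _ _ HI It H1 K1).
  - exact (D_in_unique _ _ _ _ _ HI It H2 K2).
  - exact (D_in_unique _ _ _ _ _ HI It H3 K3).
Qed.

Lemma qderiv_real (I : R -> Prop) (t : R) (f : R -> R) (v : R) :
  D_in f (fun _ => v) I t -> qderiv I t (fun s => qreal (f s)) (qreal v).
Proof.
  intros H; repeat split; [exact H | | |]; exact (Dconst I 0 t).
Qed.

Lemma qderiv_const (I : R -> Prop) (t : R) (c : quat) :
  qderiv I t (fun _ => c) (qreal 0).
Proof. repeat split; simpl; apply Dconst. Qed.

Lemma qderiv_conj (I : R -> Prop) (t : R) (p : R -> quat) (v : quat) :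
  qderiv I t p v -> qderiv I t (fun s => qconj (p s)) (qconj v).
Proof.
  intros (H0 & H1 & H2 & H3); repeat split; [exact H0 | | |].
  - exact (Dopp _ _ _ _ H1).
  - exact (Dopp _ _ _ _ H2).
  - exact (Dopp _ _ _ _ H3).
Qed.

Lemma qderiv_add (I : R -> Prop) (t : R) (p q : R -> quat) (v w : quat) :
  qderiv I t p v -> qderiv I t q w -> qderiv I t (fun s => (p s + q s)%H) (v + w)%H.
Proof.
  intros (H0 & H1 & H2 & H3) (K0 & K1 & K2 & K3); repeat split.
  - exact (Dadd _ _ _ _ _ _ H0 K0).
  - exact (Dadd _ _ _ _ _ _ H1 K1).
  - exact (Dadd _ _ _ _ _ _ H2 K2).
  - exact (Dadd _ _ _ _ _ _ H3 K3).
Qed.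

Lemma D_in_eq_value (I : R -> Prop) (f d : R -> R) (t v : R) :
  D_in f d I t -> d t = v -> D_in f (fun _ => v) I t.
Proof. intros H <-; exact H. Qed.

Lemma qderiv_mul (I : R -> Prop) (t : R) (p q : R -> quat) (v w : quat) :
  qderiv I t p v -> qderiv I t q w ->
  qderiv I t (fun s => (p s * q s)%H) (v * q t + p t * w)%H.
Proof.
  intros (H0 & H1 & H2 & H3) (K0 & K1 & K2 & K3); repeat split; simpl.
  all: eapply D_in_eq_value;
    [ repeat first [ apply Dminus | apply Dadd | apply Dmult ]; eassumption
    | simpl; ring ].
Qed.

(** * Real multiples of a differentiable unit field *)

Lemma real_factor_derivable (I : R -> Prop) (t : R) (s : R -> R)
    (x u : R -> quat) (v w : quat) :
  I t -> (forall a, I a -> unit_quat (u a)) ->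
  (forall a, I a -> x a = (qreal (s a) * u a)%H) ->
  qderiv I t x v -> qderiv I t u w -> exists s', D_in s (fun _ => s') I t.
Proof.
  intros It Hu Hx Dx Du.
  destruct (qderiv_mul _ _ _ _ _ _ Dx (qderiv_conj _ _ _ _ Du)) as [D _].
  eexists; apply (fun H => D_in_ext _ _ _ _ _ It H D).
  intros a Ia; symmetry; apply real_factor_of_unit; auto.
Qed.

(** The real factor between two parallel unit fields squares to [1], so its
    derivative vanishes; the fields then satisfy the same linear equation. *)
Lemma unit_parallel_derivative (I : R -> Prop) (t : R) (s : R -> R)
    (x u : R -> quat) (k v : quat) :
  is_interval I -> I t ->
  (forall a, I a -> unit_quat (u a)) -> (forall a, I a -> unit_quat (x a)) ->
  (forall a, I a -> x a = (qreal (s a) * u a)%H) ->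
  qderiv I t u (k * u t)%H -> qderiv I t x v -> v = (k * x t)%H.
Proof.
  intros HI It Hu Hx Hxu Du Dx.
  destruct (real_factor_derivable _ _ _ _ _ _ _ It Hu Hxu Dx Du) as [s' Ds].
  assert (Hsq : forall a, I a -> s a * s a = 1)
    by (intros a Ia; apply (unit_real_factor_square (s a) (x a) (u a)); auto).
  assert (Hs' : s' = 0).
  { assert (H : s' * s t + s t * s' = 0).
    { apply (D_in_unique I (fun _ => 1) (fun a => s' * s a + s a * s')
               (fun _ => 0) t HI It); [|apply Dconst].
      apply (D_in_ext I _ _ _ t It Hsq).
      exact (Dmult _ _ _ _ _ _ Ds Ds). }
    pose proof (Hsq t It); nra. }
  subst s'.
  assert (Dx' : qderiv I t x (qreal 0 * u t + qreal (s t) * (k * u t))%H).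
  { apply (qderiv_ext I t (fun a => (qreal (s a) * u a)%H)); auto.
    - intros a Ia; symmetry; auto.
    - exact (qderiv_mul _ _ (fun a => qreal (s a)) u _ _
               (qderiv_real _ _ _ _ Ds) Du). }
  rewrite (qderiv_unique _ _ _ _ _ HI It Dx Dx'), (Hxu t It).
  quat_ring.
Qed.

(** * The evolute *)

Theorem proposition4p1
    (I : R -> Prop) (hI : is_interval I)
    (q dq : R -> quat) (hq : regular_curve I q dq)
    (hlen : forall t, I t -> qnorm (dq t) = 1)
    (kappa : R -> quat) (hkappa : is_curvature I dq kappa)
    (hkappa0 : forall t, I t -> kappa t <> qreal 0)
    (omega : quat)
    (homega : forall t, I t -> qscale (/ qnorm (kappa t)) (kappa t) = omega)
    (dqE : R -> quat)
    (hqE : regular_curve I (center_of_curvature q dq kappa omega) dqE)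
    (kappaE : R -> quat) (hkappaE : is_curvature I dqE kappaE) :
  forall t, I t ->
    im1 (kappaE t) * qnorm (dqE t) = im1 (kappa t) /\
    im2 (kappaE t) * qnorm (dqE t) = im2 (kappa t) /\
    im3 (kappaE t) * qnorm (dqE t) = im3 (kappa t).
Proof.
  destruct hq as (_ & Dq & _), hqE as (_ & DqE & dqE0).
  destruct hkappa as [kappa_im Ddq], hkappaE as [_ DT].
  set (r := fun s => 1 / qnorm (kappa s)).
  set (u := fun s => (omega * dq s)%H).
  set (T := fun s => qscale (/ qnorm (dqE s)) (dqE s)).
  assert (homega_unit : forall s, I s -> unit_quat omega).
  { intros s Is; rewrite <- (homega s Is); apply normalize_unit; auto. }
  assert (homega_sq : forall s, I s -> (omega * omega = qreal (-1))%H).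
  { intros s Is; apply imaginary_unit_square; [|exact (homega_unit s Is)].
    rewrite <- (homega s Is); simpl; rewrite (kappa_im s Is); ring. }
  assert (hkappa_omega : forall s, I s ->
            kappa s = (qreal (qnorm (kappa s)) * omega)%H).
  { intros s Is; rewrite <- (homega s Is), <- qscale_qreal.
    apply qscale_normalize; auto. }
  assert (Hu : forall s, I s -> unit_quat (u s)).
  { intros s Is; apply unit_quat_mul; [exact (homega_unit s Is)|].
    apply qnorm_1_unit; auto. }
  assert (HT : forall s, I s -> unit_quat (T s)).
  { intros s Is; apply normalize_unit; auto. }
  assert (Ddq' : forall s, I s -> qderiv I s dq (kappa s * dq s)%H).
  { intros s Is; refine (qderiv_ext _ _ _ _ _ Is _ (Ddq s Is)).
    intros a Ia; rewrite (hlen a Ia); apply quat_eq; simpl; field. }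
  assert (Du : forall s, I s -> qderiv I s u (kappa s * u s)%H).
  { intros s Is.
    pose proof (qderiv_mul I s (fun _ => omega) dq _ _
                  (qderiv_const I s omega) (Ddq' s Is)) as D.
    replace (kappa s * u s)%H
      with (qreal 0 * dq s + omega * (kappa s * dq s))%H; [exact D|].
    unfold u; rewrite (hkappa_omega s Is); quat_ring. }
  assert (HE : forall s, I s ->
            (q s + qreal (r s) * u s = center_of_curvature q dq kappa omega s)%H).
  { intros s _; unfold center_of_curvature, u, r; quat_ring. }
  (* The tangent of the evolute is [r' u]: the derivative [dq] of [q] cancels
     against [r kappa u = omega u = omega^2 dq]. *)
  assert (Htangent : forall s, I s -> exists r', dqE s = (qreal r' * u s)%H).
  { intros s Is.
    destruct (real_factor_derivable I s r
                (fun a => (center_of_curvature q dq kappa omega a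
                           + qreal (-1) * q a)%H) u
                (dqE s + (qreal 0 * q s + qreal (-1) * dq s))%H
                (kappa s * u s)%H Is Hu) as [r' Dr].
    - intros a Ia; rewrite <- (HE a Ia); quat_ring.
    - exact (qderiv_add _ _ _ _ _ _ (DqE s Is)
               (qderiv_mul _ _ _ _ _ _ (qderiv_const I s (qreal (-1))) (Dq s Is))).
    - exact (Du s Is).
    - exists r'.
      pose proof (qderiv_add _ _ _ _ _ _ (Dq s Is)
                    (qderiv_mul _ _ (fun a => qreal (r a)) u _ _
                       (qderiv_real _ _ _ _ Dr) (Du s Is))) as D.
      apply (qderiv_ext I s _ _ _ Is HE) in D.
      rewrite (qderiv_unique _ _ _ _ _ hI Is (DqE s Is) D).
      assert (Hcancel : (qreal (r s) * (kappa s * u s) = qreal (-1) * dq s)%H).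
      { rewrite (hkappa_omega s Is) at 1; unfold u.
        rewrite !qmul_assoc, qreal_mul, <- (qmul_assoc _ omega omega),
          (homega_sq s Is), qreal_mul.
        do 2 f_equal; unfold r; field; apply qnorm_neq0; auto. }
      rewrite Hcancel; quat_ring. }
  (* The real factor between [T] and [u], in the closed form given by
     [real_factor_of_unit]. *)
  assert (HTu : forall s, I s -> T s = (qreal (re (T s * qconj (u s))) * u s)%H).
  { intros s Is; destruct (Htangent s Is) as [r' Hr'].
    assert (H : T s = (qreal (/ qnorm (dqE s) * r') * u s)%H).
    { unfold T; rewrite qscale_qreal; rewrite Hr' at 2.
      rewrite qmul_assoc, qreal_mul; reflexivity. }
    rewrite <- (real_factor_of_unit _ _ _ (Hu s Is) H); exact H. }
  intros t It.
  assert (Hcurv : (kappaE t * dqE t = kappa t * T t)%H)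
    by exact (unit_parallel_derivative I t _ T u _ _ hI It Hu HT HTu
                (Du t It) (DT t It)).
  rewrite (qscale_normalize (dqE t) (dqE0 t It)) in Hcurv; fold (T t) in Hcurv.
  rewrite qscale_qreal, qmul_assoc in Hcurv.
  apply (unit_quat_cancel_r _ _ _ (HT t It)) in Hcurv.
  rewrite qmul_qreal_comm in Hcurv; rewrite <- Hcurv; simpl.
  repeat split; ring.
Qed.
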